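(* Let $G$ be a finite group. For all $i,h,l,m\in G$, $$\sum_{g\in G}P(g,i,h)\,P(g,l,m)=\sum_{g\in G}P(g,l^{-1},i)\,P(g,m,h^{-1}).$$
   Context: For a finite group $G$ and $g,i,h\in G$, define $$P(g,i,h):=\#\{(j_1,j_2)\in G^2\mid g=j_2\,i\,j_2^{-1}\,j_1\,h\,j_1^{-1}\}.$$ *)

(* Defs.v *)
From mathcomp Require Import all_boot all_fingroup.

Set Implicit Arguments.
Unset Strict Implicit.
Unset Printing Implicit Defensive.

Local Open Scope group_scope.

(* The pair j is (j_1, j_2). The conjugates are written out because [x ^ y]   *)
(* is [y^-1 * x * y], the opposite convention.                                *)
Definition P (gT : finGroupType) (G : {group gT}) (g i h : gT) : nat :=
  #|[set j in setX G G | g == j.2 * i * j.2^-1 * j.1 * h * j.1^-1]|.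

(* Main.v *)
Require Import Defs.
From mathcomp Require Import all_boot all_fingroup.

Local Open Scope group_scope.

(** The left-hand side counts the quadruples (a, b, c, d) in G^4 with I H = L M,
    where I, H, L, M are the conjugates of i, h, l, m by a, b, c, d; the
    right-hand side counts those with L^-1 I = M H^-1, which is the same
    equation. *)

Lemma P_sum (gT : finGroupType) (G : {group gT}) (g i h : gT) :
  P G g i h = (\sum_(a in G) \sum_(b in G)
                 (g == a * i * a^-1 * (b * h * b^-1))%g)%N.
Proof.
(* Here [a] is $j_2$ and [b] is $j_1$, so the sums are exchanged before pairing. *)
rewrite /P -sum1_card exchange_big pair_big big_mkcond [RHS]big_mkcond.
apply: eq_bigr => -[b a] _; rewrite !inE /= !mulgA.
by case: (_ && (a \in G)); case: (_ == _).
Qed.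

Lemma sum_delta_mul (T : finType) (A : {set T}) (x y : T) :
  x \in A -> (\sum_(g in A) (g == x) * (g == y))%N = (x == y).
Proof.
move=> xA; rewrite (bigD1 x) //= eqxx mul1n big1 ?addn0 // => g.
by case/andP=> _ /negPf->.
Qed.

(** For fixed conjugators only one [g] can survive, the product of the conjugates of [i] and [h]; it
    lies in [G] because [i] and [h] do. *)
Lemma sum_PP (gT : finGroupType) (G : {group gT}) (i h l m : gT) :
  i \in G -> h \in G ->
  (\sum_(g in G) P G g i h * P G g l m)%N =
  (\sum_(a in G) \sum_(b in G) \sum_(c in G) \sum_(d in G)
     (a * i * a^-1 * (b * h * b^-1) == c * l * c^-1 * (d * m * d^-1))%g)%N.
Proof.
move=> iG hG.
under eq_bigr => g _.
  rewrite !P_sum big_distrl /=.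
  under eq_bigr => a _.
    rewrite big_distrl /=.
    under eq_bigr => b _.
      rewrite big_distrr /=.
      under eq_bigr do rewrite big_distrr /=.
      over.
    over.
  over.
(* Each exchange moves the sum over [g] one level inwards, until it meets only the two
   indicators. *)
rewrite exchange_big; apply: eq_bigr => a aG.
rewrite exchange_big; apply: eq_bigr => b bG.
rewrite exchange_big; apply: eq_bigr => c _.
rewrite exchange_big; apply: eq_bigr => d _.
by rewrite sum_delta_mul // !groupM ?groupV.
Qed.

Theorem mainTheorem5 (gT : finGroupType) (G : {group gT}) (i h l m : gT)
  (iG : i \in G) (hG : h \in G) (lG : l \in G) (mG : m \in G) :
  (\sum_(g in G) P G g i h * P G g l m)%N =
  (\sum_(g in G) P G g l^-1 i * P G g m h^-1)%N.
Proof.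
(* The right-hand conjugators come in the order of [l], [i], [m], [h]; the exchanges bring both
   sides to the order [i], [l], [m], [h]. *)
rewrite !sum_PP ?groupV // [RHS]exchange_big; apply: eq_bigr => a _.
rewrite exchange_big; apply: eq_bigr => c _.
rewrite exchange_big; apply: eq_bigr => d _.
apply: eq_bigr => b _; congr (nat_of_bool _).
have conjVK (x y : gT) : x * y^-1 * x^-1 = (x * y * x^-1)^-1.
  by rewrite !invMg invgK mulgA.
rewrite !conjVK; move: (a * _ * _) (b * _ * _) (c * _ * _) (d * _ * _).
move=> I H L M; rewrite [RHS]eq_sym -[RHS](inj_eq (mulgI L)) mulKVg.
by rewrite mulgA divg_eq eq_sym.
Qed.
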